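(* Let $0<r<1$ and let $\underline{T}=(T_1,\dots,T_d)$ be a doubly commuting tuple of invertible operators acting on a Hilbert space $\mathcal H$. Then the following are equivalent: (1) $T_1,\dots,T_d\in C_{1,r}$; (2) there exist a Hilbert space $\mathcal K$, an isometry $V:\mathcal H\to\mathcal K$ and a doubly commuting tuple $\underline{J}=(J_1,\dots,J_d)$ of invertible operators on $\mathcal K$ such that $T_1^{n_1}\cdots T_d^{n_d}=V^*J_1^{n_1}\cdots J_d^{n_d}V$ for all integers $n_1,\dots,n_d$, and $(1+r^2)I_{\mathcal K}-J_m^*J_m-r^2J_m^{-1}J_m^{-*}=0$ for $1\le m\le d$.
   Context: All operators are bounded linear operators on complex Hilbert spaces. $C_{1,r}=\{T: T\text{ invertible},\ \|T\|\le 1,\ \|rT^{-1}\|\le 1\}$. A tuple $(T_1,\dots,T_d)$ is doubly commuting if $T_iT_j=T_jT_i$ for all $i,j$ and $T_iT_j^*=T_j^*T_i$ for all $i\neq j$. $J^{-*}$ denotes $(J^{-1})^*$. *)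

(* Defs.v *)
From mathcomp Require Import all_boot all_algebra.
From mathcomp Require Import reals.
From mathcomp.real_closed Require Import complex.
From Stdlib Require Import ClassicalEpsilon.
Set Implicit Arguments. Unset Strict Implicit. Unset Printing Implicit Defensive.
Import GRing.Theory Num.Theory.
Local Open Scope ring_scope.
Local Open Scope complex_scope.

Record hilbert (R : realType) := Hilbert {
  hsort :> lmodType R[i];
  hinner : hsort -> hsort -> R[i];
  hinnerDZl : forall (a : R[i]) (x y z : hsort),
      hinner (a *: x + y) z = a * hinner x z + hinner y z;
  hinnerC : forall x y : hsort, hinner y x = (hinner x y)^*;
  hinner_ge0 : forall x : hsort, 0 <= hinner x x;
  hinner_eq0 : forall x : hsort, hinner x x = 0 -> x = 0;
  hcomplete : forall u : nat -> hsort,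
      (forall e : R, 0 < e -> exists N : nat, forall m n : nat, (N <= m)%N -> (N <= n)%N ->
          Num.sqrt (complex.Re (hinner (u m - u n) (u m - u n))) < e) ->
      exists l : hsort, forall e : R, 0 < e -> exists N : nat, forall n : nat, (N <= n)%N ->
          Num.sqrt (complex.Re (hinner (u n - l) (u n - l))) < e
}.

Section Ops.
Variable R : realType.

Definition hnorm (H : hilbert R) (x : H) : R :=
  Num.sqrt (complex.Re (hinner x x)).

Definition is_linear (H K : hilbert R) (A : H -> K) : Prop :=
  forall (a : R[i]) (x y : H), A (a *: x + y) = a *: A x + A y.

Definition bounded_op (H K : hilbert R) (A : H -> K) : Prop :=
  is_linear A /\ exists M : R, forall x : H, hnorm (A x) <= M * hnorm x.

Definition opnorm_le (H K : hilbert R) (A : H -> K) (c : R) : Prop :=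
  forall x : H, hnorm (A x) <= c * hnorm x.

Definition invertible_op (H : hilbert R) (A : H -> H) : Prop :=
  bounded_op A /\ exists B : H -> H, bounded_op B /\
    (forall x, B (A x) = x) /\ (forall x, A (B x) = x).

(* the inverse A^{-1} (chosen; it is the inverse whenever A is invertible) *)
Definition inv_op (H : hilbert R) (A : H -> H) : H -> H :=
  epsilon (inhabits id) (fun B : H -> H => (forall x, B (A x) = x) /\ (forall x, A (B x) = x)).

Definition op_adj (H K : hilbert R) (A : H -> K) : K -> H :=
  epsilon (inhabits (fun _ => 0))
    (fun B : K -> H => forall (x : H) (y : K), hinner (A x) y = hinner x (B y)).

Definition op_isometry (H K : hilbert R) (V : H -> K) : Prop :=
  is_linear V /\ forall x : H, hnorm (V x) = hnorm x.

Definition op_zpow (H : hilbert R) (A : H -> H) (n : int) : H -> H :=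
  match n with
  | Posz k => iter k A
  | Negz k => iter k.+1 (inv_op A)
  end.

Definition multi_pow (H : hilbert R) (d : nat) (T : 'I_d -> H -> H) (n : 'I_d -> int) : H -> H :=
  foldr (fun i acc => op_zpow (T i) (n i) \o acc) id (enum 'I_d).

Definition doubly_commuting (H : hilbert R) (d : nat) (T : 'I_d -> H -> H) : Prop :=
  (forall i j : 'I_d, forall x, T i (T j x) = T j (T i x)) /\
  (forall i j : 'I_d, i != j -> forall x, T i (op_adj (T j) x) = op_adj (T j) (T i x)).

Definition C1r (H : hilbert R) (r : R) (T : H -> H) : Prop :=
  invertible_op T /\ opnorm_le T 1 /\ opnorm_le (fun x => r%:C *: inv_op T x) 1.

End Ops.

(* Main.v *)
(* For P = T^* T the hypotheses on T say r^2 <= P <= 1, and the equation for J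
   says (P - 1) (P - r^2) = 0 with P = J^* J, which forces r^2 <= P <= 1 and so
   gives the bounds on J and J^-1 that V^* . V transports to T.
   Conversely, one operator is treated at a time: with D the square root of
   (1 - P) (P - r^2), the operator [[T, T^-* D], [0, r T^-*]] on H + H solves
   the equation, leaves H + 0 invariant together with its inverse, and doubly
   commutes with S + S whenever S doubly commutes with T.  The inverse-free form
   (1 + r^2) P - P^2 - r^2 = 0 of the equation is inherited by S + S. *)
Require Import Defs.
From mathcomp Require Import all_boot all_order all_algebra.
From mathcomp Require Import reals classical_sets boolp.
From mathcomp.real_closed Require Import complex.
From mathcomp Require Import ring lra.
From Stdlib Require Import ClassicalEpsilon.
Import Order.TTheory GRing.Theory Num.Theory.
Set Implicit Arguments. Unset Strict Implicit. Unset Printing Implicit Defensive.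
Local Open Scope ring_scope.
Local Open Scope complex_scope.

(** The matrix comes from a 2 x 2 computation. Cayley-Hamilton yields the equation as soon as
    [J^* J] has commuting entries, trace [1 + r^2] and determinant [r^2]. If [J] extends [T], the
    upper left entry is [P], so the lower right one is [1 + r^2 - P], and a self-adjoint
    off-diagonal entry [D] must satisfy [D^2 = P (1 + r^2 - P) - r^2 = (1 - P) (P - r^2)], which is
    nonnegative because [r^2 <= P <= 1]. An arbitrary root would not do: [D] has to commute with
    everything that commutes with [P], both for the computation itself and for the other members of
    the tuple. Hence it is built as a limit of polynomials in [P]. Aiming at an extension rather
    than a mere compression makes all integer powers restrict at once, so no joint moments have to
    be matched. Limits are handled throughout by explicit rates [c / (n + 1)]. *)

(** * The real part of the inner product and the norm *)

Definition rdot (R : realType) (H : hilbert R) (x y : H) : R :=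
  complex.Re (hinner x y).

Lemma hinnerDl (R : realType) (H : hilbert R) (x y z : H) :
  hinner (x + y) z = hinner x z + hinner y z.
Proof. by rewrite -[x in x + y]scale1r hinnerDZl mul1r. Qed.

Lemma hinner0l (R : realType) (H : hilbert R) (z : H) : hinner 0 z = 0.
Proof. by apply: (addrI (hinner 0 z)); rewrite -hinnerDl !addr0. Qed.

Lemma hinnerZl (R : realType) (H : hilbert R) (a : R[i]) (x z : H) :
  hinner (a *: x) z = a * hinner x z.
Proof. by rewrite -[a *: x]addr0 hinnerDZl hinner0l addr0. Qed.

Lemma rdotC (R : realType) (H : hilbert R) (x y : H) : rdot x y = rdot y x.
Proof. by rewrite /rdot hinnerC; case: (hinner y x). Qed.

Lemma rdotDl (R : realType) (H : hilbert R) (x y z : H) :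
  rdot (x + y) z = rdot x z + rdot y z.
Proof.
by rewrite /rdot hinnerDl; case: (hinner x z) => a b; case: (hinner y z).
Qed.

Lemma rdotZl (R : realType) (H : hilbert R) (a : R) (x z : H) :
  rdot (a%:C *: x) z = a * rdot x z.
Proof.
by rewrite /rdot hinnerZl; case: (hinner x z) => u v /=; rewrite mul0r subr0.
Qed.

Lemma rdotNl (R : realType) (H : hilbert R) (x z : H) :
  rdot (- x) z = - rdot x z.
Proof.
have := rdotDl x (- x) z; rewrite subrr {1}/rdot hinner0l /=; lra.
Qed.

Lemma rdotDr (R : realType) (H : hilbert R) (x y z : H) :
  rdot z (x + y) = rdot z x + rdot z y.
Proof. by rewrite ![rdot z _]rdotC rdotDl. Qed.

Lemma rdotZr (R : realType) (H : hilbert R) (a : R) (x z : H) :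
  rdot z (a%:C *: x) = a * rdot z x.
Proof. by rewrite ![rdot z _]rdotC rdotZl. Qed.

Lemma rdotNr (R : realType) (H : hilbert R) (x z : H) :
  rdot z (- x) = - rdot z x.
Proof. by rewrite ![rdot z _]rdotC rdotNl. Qed.

Definition rdotE := (rdotDl, rdotDr, rdotNl, rdotNr, rdotZl, rdotZr).

Lemma rdot0l (R : realType) (H : hilbert R) (z : H) : rdot 0 z = 0.
Proof. by rewrite /rdot hinner0l. Qed.

Lemma rdot_ge0 (R : realType) (H : hilbert R) (x : H) : 0 <= rdot x x.
Proof.
by have := hinner_ge0 x; rewrite /rdot; case: (hinner x x) => a b /andP[].
Qed.

Lemma rdot_eq0 (R : realType) (H : hilbert R) (x : H) : rdot x x = 0 -> x = 0.
Proof.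
move=> x0; apply: hinner_eq0; have := hinner_ge0 x; move: x0; rewrite /rdot.
by case: (hinner x x) => a b /= -> /andP[/eqP /= -> _].
Qed.

(* Stands in for a [ring] tactic on vectors: test against [z], expand by
   [rdotE], and conclude in [R]. *)
Lemma rdot_inj (R : realType) (H : hilbert R) (x y : H) :
  (forall z, rdot x z = rdot y z) -> x = y.
Proof.
move=> xy; apply/eqP; rewrite -subr_eq0; apply/eqP/rdot_eq0.
by rewrite rdotDl rdotNl xy subrr.
Qed.

(** [rdot] loses no information: the imaginary part is recovered by a multiplication by ['i], so
    inequalities and algebra can be done in [R] and complex identities restored afterwards. *)
Lemma Im_hinner (R : realType) (H : hilbert R) (x y : H) :
  complex.Im (hinner x y) = - rdot ('i *: x) y.
Proof.
rewrite /rdot hinnerZl; case: (hinner x y) => a b /=.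
by rewrite mul0r mul1r sub0r opprK.
Qed.

Lemma hnorm_ge0 (R : realType) (H : hilbert R) (x : H) : 0 <= hnorm x.
Proof. exact: sqrtr_ge0. Qed.

Lemma hnorm_sqr (R : realType) (H : hilbert R) (x : H) :
  hnorm x ^+ 2 = rdot x x.
Proof. by rewrite sqr_sqrtr // rdot_ge0. Qed.

Lemma hnorm0 (R : realType) (H : hilbert R) : hnorm (0 : H) = 0.
Proof. by apply/eqP; rewrite -sqrf_eq0 hnorm_sqr rdot0l. Qed.

Lemma hnorm_eq0 (R : realType) (H : hilbert R) (x : H) : hnorm x = 0 -> x = 0.
Proof. by move=> x0; apply: rdot_eq0; rewrite -hnorm_sqr x0 expr0n. Qed.

Lemma hnorm_le (R : realType) (H K : hilbert R) (c : R) (x : H) (y : K) :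
  0 <= c -> rdot x x <= c ^+ 2 * rdot y y -> hnorm x <= c * hnorm y.
Proof.
move=> c0 xy; rewrite -(@ler_pXn2r _ 2) ?nnegrE ?mulr_ge0 ?hnorm_ge0 //.
by rewrite exprMn !hnorm_sqr.
Qed.

Lemma rdot_le (R : realType) (H : hilbert R) (x y : H) :
  rdot x y <= hnorm x * hnorm y.
Proof.
have [x0|xn0] := eqVneq (hnorm x) 0.
  by rewrite x0 mul0r (hnorm_eq0 x0) rdot0l.
have xp : 0 < hnorm x by rewrite lt_def xn0 hnorm_ge0.
(* This square equals [2 |x| |y| (|x| |y| - rdot x y)]. *)
have := rdot_ge0 ((hnorm y)%:C *: x - (hnorm x)%:C *: y).
rewrite !rdotE (rdotC y x) -!hnorm_sqr => h.
have [y0|yn0] := eqVneq (hnorm y) 0.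
  by rewrite y0 mulr0 (hnorm_eq0 y0) rdotC rdot0l.
have yp : 0 < hnorm y by rewrite lt_def yn0 hnorm_ge0.
have xy : 0 < hnorm x * hnorm y by exact: mulr_gt0.
rewrite -(ler_pM2l xy); nra.
Qed.

Lemma normr_rdot (R : realType) (H : hilbert R) (x y : H) :
  `|rdot x y| <= hnorm x * hnorm y.
Proof.
rewrite ler_norml rdot_le andbT lerNl -rdotNl.
apply: le_trans (rdot_le _ _) _.
by rewrite {1}/hnorm -/(rdot _ _) !rdotE opprK.
Qed.

Lemma ler_hnormD (R : realType) (H : hilbert R) (x y : H) :
  hnorm (x + y) <= hnorm x + hnorm y.
Proof.
rewrite -(@ler_pXn2r _ 2) ?nnegrE ?addr_ge0 ?hnorm_ge0 //.
rewrite hnorm_sqr !rdotE (rdotC y x) -!hnorm_sqr; have := rdot_le x y; nra.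
Qed.

Lemma opp_hnorm (R : realType) (H : hilbert R) (x : H) : hnorm (- x) = hnorm x.
Proof. by rewrite /hnorm -!/(rdot _ _) !rdotE opprK. Qed.

Lemma hdistC (R : realType) (H : hilbert R) (x y : H) :
  hnorm (x - y) = hnorm (y - x).
Proof. by rewrite -opp_hnorm opprB. Qed.

Lemma hnorm_scale (R : realType) (H : hilbert R) (a : R) (x : H) :
  hnorm (a%:C *: x) = `|a| * hnorm x.
Proof.
rewrite /hnorm -!/(rdot _ _) !rdotE mulrA -expr2 sqrtrM ?sqr_ge0 //.
by rewrite sqrtr_sqr.
Qed.

Lemma hnorm_small (R : realType) (H : hilbert R) (x : H) :
  (forall e : R, 0 < e -> hnorm x <= e) -> x = 0.
Proof.
move=> h; apply: hnorm_eq0; apply/eqP; rewrite eq_le hnorm_ge0 andbT.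
by apply/ler_addgt0Pr => e e0; rewrite add0r h.
Qed.

Section Linear.
Context (R : realType) (H K : hilbert R) (A : H -> K) (lA : is_linear A).

Lemma linD x y : A (x + y) = A x + A y.
Proof. by rewrite -[x in LHS]scale1r lA scale1r. Qed.

Lemma lin0 : A 0 = 0.
Proof. by apply: (addrI (A 0)); rewrite -linD !addr0. Qed.

Lemma linZ a x : A (a *: x) = a *: A x.
Proof. by rewrite -[a *: x]addr0 lA lin0 addr0. Qed.

Lemma linN x : A (- x) = - A x.
Proof. by rewrite -scaleN1r linZ scaleN1r. Qed.

Lemma linB x y : A (x - y) = A x - A y.
Proof. by rewrite linD linN. Qed.

End Linear.

(** * Completeness with a rate, and Riesz representation *)

Lemma harmonic_small (R : realType) (c e : R) : 0 <= c -> 0 < e ->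
  exists N : nat, forall n, (N <= n)%N -> c / n.+1%:R < e.
Proof.
move=> c0 e0; exists (Num.bound (c / e)) => n Nn.
have := archi_boundP (divr_ge0 c0 (ltW e0)).
rewrite ltr_pdivrMr // ltr_pdivrMr ?ltr0Sn // => h.
rewrite mulrC; apply: (lt_le_trans h); rewrite ler_pM2r // ler_nat.
exact: leq_trans Nn (leqnSn n).
Qed.

Lemma hilbert_cauchy (R : realType) (H : hilbert R) (u : nat -> H) (c : R) :
  0 <= c ->
  (forall m n, (m <= n)%N -> hnorm (u m - u n) <= c / m.+1%:R) ->
  exists l, forall n, hnorm (u n - l) <= c / n.+1%:R.
Proof.
move=> c0 hu; have [e e0|l hl] := @hcomplete _ H u.
  have [N hN] := harmonic_small c0 e0; exists N => m n Nm Nn.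
  case: (leqP m n) => mn; first exact: le_lt_trans (hu _ _ mn) (hN _ Nm).
  change (hnorm (u m - u n) < e); rewrite hdistC.
  exact: le_lt_trans (hu _ _ (ltnW mn)) (hN _ Nn).
exists l => n; apply/ler_addgt0Pr => e e0; have [N hN] := hl e e0.
have -> : u n - l = (u n - u (maxn n N)) + (u (maxn n N) - l).
  by rewrite addrA subrK.
apply: le_trans (ler_hnormD _ _) (lerD (hu _ _ (leq_maxl _ _)) _).
exact/ltW/hN/leq_maxr.
Qed.

(** The representing vector is the minimizer of [phi z = |z|^2 - 2 g z]; a minimizing sequence is
    Cauchy, so no closed subspace or projection is needed. *)
Lemma riesz (R : realType) (H : hilbert R) (g : H -> R) (M : R) :
  (forall x y, g (x + y) = g x + g y) ->
  (forall (a : R) x, g (a%:C *: x) = a * g x) ->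
  (forall x, `|g x| <= M * hnorm x) ->
  exists z, forall w, g w = rdot w z.
Proof.
move=> gD gZ gM; pose phi z := rdot z z - 2 * g z.
pose m := inf (range phi).
have hinf : has_inf (range phi).
  split; first by exists (phi 0); exists 0.
  (* From [|z|^2 - 2 M |z| >= - M^2]. *)
  exists (- M ^+ 2) => _ [z _ <-]; rewrite /phi -hnorm_sqr.
  have := gM z; rewrite ler_norml => /andP[_ h]; have := sqr_ge0 (hnorm z - M).
  nra.
have phi_ge z : m <= phi z by apply: ge_inf; [case: hinf | exists z].
(* The accuracy is squared because an error [e^2] in [phi] only controls the first variation up to
   [e]. *)
have ex n : exists u, phi u < m + (n.+1%:R^-1) ^+ 2.
  have [|_ [u _ <-] h] := @inf_adherent _ _ ((n.+1%:R^-1 : R) ^+ 2) _ hinf.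
    by rewrite exprn_gt0 // invr_gt0 ltr0Sn.
  by exists u.
have [u hu] := boolp.choice ex.
have dev n w : `|rdot (u n) w - g w| <= n.+1%:R^-1 * hnorm w.
  set a := rdot _ _ - _; set e : R := n.+1%:R^-1.
  have e0 : 0 <= e by rewrite invr_ge0 ler0n.
  have quad t : 0 <= t ^+ 2 * rdot w w + 2 * t * a + e ^+ 2.
    have := phi_ge (u n + t%:C *: w); have := hu n.
    rewrite /phi gD gZ !rdotE (rdotC w) -/e /a; nra.
  rewrite -(@ler_pXn2r _ 2) ?nnegrE ?mulr_ge0 ?hnorm_ge0 ?normr_ge0 //.
  rewrite -normrX ger0_norm ?sqr_ge0 // exprMn hnorm_sqr.
  have [w0|wn0] := eqVneq (rdot w w) 0.
    have g0 : g 0 = 0 by apply: (addrI (g 0)); rewrite -gD !addr0.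
    by rewrite /a (rdot_eq0 w0) g0 rdotC !rdot0l subr0 expr0n mulr0.
  have wp : 0 < rdot w w by rewrite lt_def wn0 rdot_ge0.
  (* The minimizing [t] of the quadratic, which gives the discriminant bound [a^2 <= e^2 |w|^2]. *)
  have := quad (- a / rdot w w); rewrite -(pmulr_rge0 _ wp).
  suff -> : rdot w w * ((- a / rdot w w) ^+ 2 * rdot w w
     + 2 * (- a / rdot w w) * a + e ^+ 2) = e ^+ 2 * rdot w w - a ^+ 2.
    by rewrite subr_ge0.
  by field.
(* With [w = u k - u k'], two uses of [dev] give [|w|^2 <= (1/(k+1) + 1/(k'+1)) |w|], whence the
   constant 2. *)
have [k k' kk'|z hz] := @hilbert_cauchy _ _ u 2 (ler0n _ _).
  set w := u k - u k'; have := dev k w; have := dev k' w.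
  have le : (k'.+1%:R^-1 : R) <= k.+1%:R^-1.
    by rewrite lef_pV2 ?posrE ?ltr0Sn // ler_nat.
  have w0 := hnorm_ge0 w.
  have ww : rdot w w = (rdot (u k) w - g w) - (rdot (u k') w - g w).
    by rewrite {1}/w !rdotE; ring.
  rewrite !ler_norml => /andP[h1 h2] /andP[h3 h4].
  have [->|wn0] := eqVneq (hnorm w) 0; first by rewrite divr_ge0 ?ler0n.
  have wp : 0 < hnorm w by rewrite lt_def wn0.
  rewrite -(ler_pM2r wp) -expr2 hnorm_sqr ww.
  move: h1 h2 h3 h4 (ler_wpM2r w0 le).
  set e1 := k.+1%:R^-1; set e2 := k'.+1%:R^-1.
  set b := hnorm w; set a1 := rdot _ _ - _; set a2 := rdot _ _ - _. lra.
exists z => w; rewrite rdotC; apply/eqP; rewrite -subr_eq0 -normr_eq0.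
rewrite eq_le normr_ge0 andbT; apply/ler_addgt0Pr => e e0; rewrite add0r.
(* 3 = 2 for the distance from [u N] to [z], plus 1 from [dev]. *)
have [N hN] := harmonic_small (mulr_ge0 (ler0n R 3) (hnorm_ge0 w)) e0.
apply: le_trans (ltW (hN N (leqnn _))).
have -> : g w - rdot z w = rdot (u N - z) w - (rdot (u N) w - g w).
  by rewrite !rdotE; ring.
apply: le_trans (ler_normB _ _) _.
have := dev N w; have := normr_rdot (u N - z) w; have := hz N.
have w0 := hnorm_ge0 w.
move=> /(ler_wpM2r w0); set e' := _^-1; set b := hnorm _ ; set b' := hnorm _.
nra.
Qed.

(** * Adjoints and inverses of bounded operators *)

(** A relation, so that an explicit candidate can be checked first and then identified with the
    chosen [op_adj] by uniqueness ([op_adjE]). *)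
Definition adjoint (R : realType) (H K : hilbert R) (A : H -> K) (B : K -> H) :=
  forall x y, hinner (A x) y = hinner x (B y).

Lemma adjoint_rdot (R : realType) (H K : hilbert R) (A : H -> K) (B : K -> H) :
  adjoint A B -> forall x y, rdot (A x) y = rdot x (B y).
Proof. by move=> AB x y; rewrite /rdot AB. Qed.

(** The real identity at [x] and at ['i *: x] gives both parts of the complex one. *)
Lemma rdot_adjoint (R : realType) (H K : hilbert R) (A : H -> K) (B : K -> H) :
  is_linear A -> (forall x y, rdot (A x) y = rdot x (B y)) -> adjoint A B.
Proof.
move=> lA AB x y; have := AB x y; have := AB ('i *: x) y; rewrite (linZ lA).
have := Im_hinner (A x) y; have := Im_hinner x (B y); rewrite /rdot.
case: (hinner (A x) y) => a b; case: (hinner x (B y)) => a' b' /= -> -> -> ->.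
by [].
Qed.

Lemma adjointC (R : realType) (H K : hilbert R) (A : H -> K) (B : K -> H) :
  adjoint A B -> adjoint B A.
Proof. by move=> AB x y; rewrite hinnerC -AB -hinnerC. Qed.

Lemma adjoint_uniq (R : realType) (H K : hilbert R) (A : H -> K)
    (B B' : K -> H) : adjoint A B -> adjoint A B' -> B =1 B'.
Proof.
move=> AB AB' y; apply: rdot_inj => z.
by rewrite !(rdotC _ z) -(adjoint_rdot AB) (adjoint_rdot AB').
Qed.

Lemma adjoint_linear (R : realType) (H K : hilbert R) (A : H -> K)
    (B : K -> H) : adjoint A B -> is_linear B.
Proof.
move=> /adjointC BA a x y; apply: rdot_inj => z.
by rewrite /rdot hinnerDZl BA hinnerDZl -!BA -hinnerDZl.
Qed.

(** Cauchy-Schwarz in [|B y|^2 = rdot (A (B y)) y], then division by [|B y|]. *)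
Lemma adjoint_opnorm (R : realType) (H K : hilbert R) (A : H -> K)
    (B : K -> H) (M : R) : 0 <= M ->
  adjoint A B -> opnorm_le A M -> opnorm_le B M.
Proof.
move=> M0 AB AM y; have [->|yn0] := eqVneq (hnorm (B y)) 0.
  by rewrite mulr_ge0 ?hnorm_ge0.
have yp : 0 < hnorm (B y) by rewrite lt_def yn0 hnorm_ge0.
rewrite -(ler_pM2l yp) -expr2 hnorm_sqr -(adjoint_rdot AB).
apply: le_trans (rdot_le _ _) _; rewrite mulrCA mulrA.
by rewrite ler_wpM2r ?hnorm_ge0 // AM.
Qed.

Lemma bounded_op_ge0 (R : realType) (H K : hilbert R) (A : H -> K) :
  bounded_op A -> exists2 M : R, 0 <= M & opnorm_le A M.
Proof.
case=> _ [M hM]; exists `|M| => [|x]; first exact: normr_ge0.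
by apply: le_trans (hM x) _; rewrite ler_wpM2r ?hnorm_ge0 ?ler_norm.
Qed.

Lemma adjoint_bounded (R : realType) (H K : hilbert R) (A : H -> K)
    (B : K -> H) : adjoint A B -> bounded_op A -> bounded_op B.
Proof.
move=> AB /bounded_op_ge0[M M0 hM]; split; first exact: adjoint_linear AB.
by exists M; apply: adjoint_opnorm hM.
Qed.

Lemma op_adjP (R : realType) (H K : hilbert R) (A : H -> K) :
  bounded_op A -> adjoint A (op_adj A).
Proof.
move=> bA; have [lA _] := bA; have [M M0 hM] := bounded_op_ge0 bA.
suff ex : exists B, adjoint A B by exact: (epsilon_spec (inhabits _) _ ex).
have ex y : exists z, forall x, rdot (A x) y = rdot x z.
  apply: (@riesz _ _ (fun x => rdot (A x) y) (M * hnorm y)) => [x z|a x|x].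
  - by rewrite (linD lA) rdotDl.
  - by rewrite (linZ lA) rdotZl.
  - apply: le_trans (normr_rdot _ _) _; rewrite mulrAC.
    by rewrite ler_wpM2r ?hnorm_ge0 // hM.
have [B hB] := boolp.choice ex; exists B.
by apply: rdot_adjoint => // x y; exact: hB.
Qed.

Lemma op_adjE (R : realType) (H K : hilbert R) (A : H -> K) (B : K -> H) :
  adjoint A B -> op_adj A =1 B.
Proof.
move=> AB; apply: adjoint_uniq (AB).
exact: (epsilon_spec (inhabits _) (fun B => adjoint A B) (ex_intro _ B AB)).
Qed.

Lemma bounded_op_comp (R : realType) (H K L : hilbert R) (A : K -> L)
    (B : H -> K) : bounded_op A -> bounded_op B -> bounded_op (A \o B).
Proof.
move=> bA bB; have [M M0 hM] := bounded_op_ge0 bA.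
have [N N0 hN] := bounded_op_ge0 bB; split=> [a x y|] /=.
  by rewrite (proj1 bB) (proj1 bA).
exists (M * N) => x; rewrite -mulrA.
by apply: le_trans (hM _) _; rewrite ler_wpM2l.
Qed.

Lemma inv_opP (R : realType) (H : hilbert R) (A : H -> H) :
  invertible_op A -> [/\ bounded_op (inv_op A), cancel A (inv_op A) &
    cancel (inv_op A) A].
Proof.
case=> _ [B [bB [AB BA]]].
have [iA iB] : cancel A (inv_op A) /\ cancel (inv_op A) A.
  exact: (epsilon_spec (inhabits _) (fun B : H -> H =>
    (forall x, B (A x) = x) /\ (forall x, A (B x) = x))
    (ex_intro _ B (conj AB BA))).
(* The choice defining [inv_op] says nothing about boundedness; uniqueness of the inverse transfers
   it from [B]. *)
split=> //; suff -> : inv_op A = B by [].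
by apply: boolp.funext => x; rewrite -{1}(BA x) iA.
Qed.

(** * Square root of [1 - A] for a self-adjoint contraction [A] *)

(* The iteration [Y := (A + Y^2) / 2] towards [1 - sqrt (1 - A)], together with
   its scalar majorant, the case [A = 1]. *)
Fixpoint sqrt_iter (R : realType) (H : hilbert R) (A : H -> H)
    (n : nat) (x : H) : H :=
  if n is n'.+1 then
    (2^-1)%:C *: (A x + sqrt_iter A n' (sqrt_iter A n' x))
  else 0.

Fixpoint sqrt_bound (R : realType) (n : nat) : R :=
  if n is n'.+1 then (1 + sqrt_bound R n' ^+ 2) / 2 else 0.

(** The error [e = 1 - y] evolves by [e - e^2 / 2], which decays like [2 / n]; the shift to [n + 2]
    makes the bound exact at [n = 0]. *)
Lemma sqrt_bound_ge (R : realType) (n : nat) :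
  1 - 2 / n.+2%:R <= sqrt_bound R n <= 1.
Proof.
elim: n => [|n /andP[h1 h2]] /=.
  by rewrite divff ?pnatr_eq0 // subrr lexx ler01.
set y := sqrt_bound R n in h1 h2 *.
have n0 : 0 <= n%:R :> R by exact: ler0n.
have d2 : 0 < n.+2%:R :> R by exact: ltr0Sn.
have d3 : 0 < n.+3%:R :> R by exact: ltr0Sn.
have y0 : 0 <= y.
  apply: le_trans h1; rewrite subr_ge0 ler_pdivrMr // mul1r.
  by rewrite (ler_nat _ 2).
set q := 2 / n.+2%:R in h1.
have qE : q * (n%:R + 2) = 2 by rewrite /q -(natrD _ n 2) addn2 divfK ?gt_eqF.
have q0 : 0 <= q by rewrite divr_ge0 ?ler0n // ltW.
set p := 2 / n.+3%:R.
have pE : p * (n%:R + 3) = 2 by rewrite /p -(natrD _ n 3) addn3 divfK ?gt_eqF.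
have p0 : 0 <= p by rewrite divr_ge0 ?ler0n // ltW.
have q1 : q <= 1 by nra.
(* One step of the error recursion applied to the claimed bound; it suffices since [e - e^2 / 2]
   increases on [[0, 1]]. *)
have pq : q - q ^+ 2 / 2 <= p.
  have -> : p = 2 / (n%:R + 3)
    by apply: (mulIf (x := n%:R + 3)); rewrite ?pE ?divfK // gt_eqF //; lra.
  have -> : q = 2 / (n%:R + 2)
    by apply: (mulIf (x := n%:R + 2)); rewrite ?qE ?divfK // gt_eqF //; lra.
  rewrite ler_pdivlMr; last by lra.
  rewrite -subr_ge0.
  have -> : 2 - (2 / (n%:R + 2) - (2 / (n%:R + 2)) ^+ 2 / 2) * (n%:R + 3)
      = 2 / (n%:R + 2) ^+ 2 :> R.
    by field; lra.
  by rewrite divr_ge0 ?ler0n ?sqr_ge0.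
apply/andP; split; nra.
Qed.

Lemma sqrt_bound_ge0 (R : realType) (n : nat) : 0 <= sqrt_bound R n.
Proof. by case: n => //= n; rewrite divr_ge0 ?addr_ge0 ?sqr_ge0 ?ler0n. Qed.

(** The modulus as an element of [R]; it bounds scalar multiplication when the limit operator is
    shown to be complex linear. *)
Definition complex_modulus (R : realType) (a : R[i]) : R :=
  Num.sqrt (complex.Re a ^+ 2 + complex.Im a ^+ 2).

Lemma hnormZc (R : realType) (H : hilbert R) (a : R[i]) (x : H) :
  hnorm (a *: x) = complex_modulus a * hnorm x.
Proof.
rewrite /hnorm /complex_modulus -sqrtrM ?addr_ge0 ?sqr_ge0 //; congr (Num.sqrt _).
rewrite hinnerZl hinnerC hinnerZl; case: a => p q.
case: (hinner x x) (hinner_ge0 x) => u v /andP[/eqP /= -> _].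
by ring.
Qed.

Section SqrtIter.
Context (R : realType) (H : hilbert R) (A : H -> H).
Context (lA : is_linear A) (nA : opnorm_le A 1).

Let Y := sqrt_iter A.
Let y := sqrt_bound R.

Lemma sqrt_iter_linear n : is_linear (Y n).
Proof.
elim: n => [|n IH] a u v /=; first by rewrite /Y /= scaler0 addr0.
rewrite /Y /= -/Y !IH lA; rewrite [in RHS]scalerA mulrC -scalerA -scalerDr.
congr (_ *: _); rewrite scalerDr -!addrA; congr (_ + _).
by rewrite addrCA.
Qed.

Lemma sqrt_iter_norm n : opnorm_le (Y n) (y n).
Proof.
elim: n => [|n IH] x; rewrite /Y /y /=; first by rewrite hnorm0 mul0r.
rewrite -/Y -/y hnorm_scale ger0_norm ?invr_ge0 ?ler0n //.
have := nA x; rewrite mul1r => h1.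
have y0 := sqrt_bound_ge0 R n.
have := ler_wpM2l y0 (IH x); have := IH (Y n x).
have := ler_hnormD (A x) (Y n (Y n x)).
rewrite -/y; nra.
Qed.

(** The difference of squares is split as [Y' (Y' - Y) + (Y' - Y) Y], with [Y'] the successor of
    [Y]. Its norm bound [(y' + y) (y' - y) / 2] is exactly the next scalar increment, so the bounds
    telescope. *)
Lemma sqrt_iter_step n x :
  hnorm (Y n.+1 x - Y n x) <= (y n.+1 - y n) * hnorm x.
Proof.
have lY := sqrt_iter_linear.
have nY := sqrt_iter_norm.
elim: n x => [|n IH] x.
  by rewrite {2}/Y {2}/y /= !subr0; exact: nY.
have -> : Y n.+2 x - Y n.+1 x = (2^-1)%:C *:
   (Y n.+1 (Y n.+1 x - Y n x) + (Y n.+1 (Y n x) - Y n (Y n x))).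
  rewrite (linB (lY _)) addrA subrK {1 2}/Y /= -/Y -scalerBr.
  by congr (_ *: _); rewrite opprD addrACA subrr add0r.
rewrite hnorm_scale ger0_norm ?invr_ge0 ?ler0n //.
set z := Y n.+1 x - Y n x.
have := ler_hnormD (Y n.+1 z) (Y n.+1 (Y n x) - Y n (Y n x)).
have := nY n.+1 z; have := IH x; have := IH (Y n x); have := nY n x.
have -> : y n.+2 - y n.+1 = (y n.+1 + y n) * (y n.+1 - y n) / 2.
  by transitivity ((1 + y n.+1 ^+ 2) / 2 - (1 + y n ^+ 2) / 2); [|field].
have y0 : 0 <= y n := sqrt_bound_ge0 R n.
have y1 : 0 <= y n.+1 := sqrt_bound_ge0 R n.+1.
have dy : 0 <= y n.+1 - y n.
  rewrite /y /= -/y; have := sqr_ge0 (1 - y n); nra.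
move=> h1 /le_trans h2 h3 h4 h5.
have {}h2 := h2 _ (ler_wpM2l dy h1).
have := ler_wpM2l y1 h3.
nra.
Qed.

Lemma sqrt_iter_cauchy n m x : (n <= m)%N ->
  hnorm (Y n x - Y m x) <= (1 - y n) * hnorm x.
Proof.
move=> nm; apply: (@le_trans _ _ ((y m - y n) * hnorm x)); last first.
  by rewrite ler_wpM2r ?hnorm_ge0 // lerB //; case/andP: (sqrt_bound_ge R m).
elim: m nm => [|m IH].
  by rewrite leqn0 => /eqP ->; rewrite !subrr mul0r hnorm0.
rewrite leq_eqVlt => /orP[/eqP ->|nm].
  by rewrite !subrr mul0r hnorm0.
have -> : Y n x - Y m.+1 x = (Y n x - Y m x) + (Y m x - Y m.+1 x).
  by rewrite addrA subrK.
apply: le_trans (ler_hnormD _ _) _.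
have := IH nm; have := sqrt_iter_step m x; rewrite hdistC; lra.
Qed.

Lemma sqrt_iter_cvg : exists S : H -> H,
  forall n x, hnorm (Y n x - S x) <= 2 * hnorm x / n.+1%:R.
Proof.
suff ex x : exists l, forall n, hnorm (Y n x - l) <= 2 * hnorm x / n.+1%:R.
  by have [S hS] := boolp.choice ex; exists S.
apply: (@hilbert_cauchy _ _ (fun n => Y n x)) => [|m n mn].
  by rewrite mulr_ge0 ?hnorm_ge0.
apply: le_trans (sqrt_iter_cauchy x mn) _; rewrite mulrAC.
rewrite ler_wpM2r ?hnorm_ge0 //.
apply: (@le_trans _ _ (2 / m.+2%:R)).
  by have /andP[+ _] := sqrt_bound_ge R m; rewrite !lerBlDr addrC.
by rewrite ler_wpM2l // lef_pV2 ?posrE ?ltr0Sn // ler_nat.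
Qed.

(** The limit [L] of the iteration satisfies [2 L = A + L^2], so [S = 1 - L] squares to [1 - A].
    Every iterate is a polynomial in [A], which gives self-adjointness and the commutation clause in
    the limit. *)
Lemma sqrt_one_sub (sA : forall x z, rdot (A x) z = rdot x (A z)) :
  exists S : H -> H, [/\ bounded_op S,
    forall x z, rdot (S x) z = rdot x (S z),
    forall x, S (S x) = x - A x &
    forall B, bounded_op B -> (forall x, B (A x) = A (B x)) ->
      forall x, B (S x) = S (B x)].
Proof.
have lY := sqrt_iter_linear; have nY := sqrt_iter_norm.
have [L hL] := sqrt_iter_cvg.
have small (z : H) (c : R) : (forall n, hnorm z <= c / n.+1%:R) -> z = 0.
  move=> h; apply: hnorm_small => e e0.
  have c0 : 0 <= c by have := h 0%N; rewrite divr1; exact/le_trans/hnorm_ge0.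
  have [N hN] := harmonic_small c0 e0.
  exact: le_trans (h N) (ltW (hN N (leqnn _))).
have rsmall (a c : R) : 0 <= c -> (forall n, `|a| <= c / n.+1%:R) -> a = 0.
  move=> c0 h; apply/eqP; rewrite -normr_eq0 eq_le normr_ge0 andbT.
  apply/ler_addgt0Pr => e e0; rewrite add0r.
  have [N hN] := harmonic_small c0 e0.
  exact: le_trans (h N) (ltW (hN N (leqnn _))).
have h0 (z : H) : 0 <= hnorm z := hnorm_ge0 z.
have sL x z : rdot (L x) z = rdot x (L z).
  apply/eqP; rewrite -subr_eq0; apply/eqP.
  apply: (@rsmall _ (4 * hnorm x * hnorm z)) => [|n].
    by rewrite !mulr_ge0 ?ler0n ?hnorm_ge0.
  have sY u v : rdot (Y n u) v = rdot u (Y n v).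
    elim: n u v => [|n IH] u v; rewrite /Y /=.
      by rewrite rdot0l rdotC rdot0l.
    by rewrite -/Y !rdotE sA !IH.
  have -> : rdot (L x) z - rdot x (L z) =
      rdot x (Y n z - L z) - rdot (Y n x - L x) z by rewrite !rdotE sY; ring.
  apply: le_trans (ler_normB _ _) _.
  have := normr_rdot x (Y n z - L z); have := normr_rdot (Y n x - L x) z.
  have := ler_wpM2l (h0 x) (hL n z); have := ler_wpM2r (h0 z) (hL n x).
  set i := n.+1%:R^-1; lra.
(* Used twice: for [B] a complex scalar, giving linearity of [L], and for the operators [B] of the
   last clause. *)
have LC (B : H -> H) (M : R) : 0 <= M -> {morph B : u v / u + v} ->
    (forall u, hnorm (B u) <= M * hnorm u) ->
    (forall n u, B (Y n u) = Y n (B u)) -> forall u, B (L u) = L (B u).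
  move=> M0 BD BM BY u; apply/eqP; rewrite -subr_eq0; apply/eqP.
  have B0 : B 0 = 0 by apply: (addrI (B 0)); rewrite -BD !addr0.
  have BN v : B (- v) = - B v.
    by apply: (addrI (B v)); rewrite -BD !subrr B0.
  apply: (small _ (4 * M * hnorm u)) => n.
  have -> : B (L u) - L (B u) = (Y n (B u) - L (B u)) - B (Y n u - L u).
    by apply: rdot_inj => z; rewrite BD BN BY !rdotE; ring.
  apply: le_trans (ler_hnormD _ _) _; rewrite opp_hnorm.
  have i0 : 0 <= n.+1%:R^-1 :> R by rewrite invr_ge0 ler0n.
  have := ler_wpM2l M0 (hL n u); have := BM (Y n u - L u); have := hL n (B u).
  have := ler_wpM2r i0 (BM u); move: i0; set i := n.+1%:R^-1; lra.
(* Self-adjointness already forces additivity. *)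
have LD : {morph L : u v / u + v}.
  by move=> u v; apply: rdot_inj => z; rewrite sL !rdotDl !sL.
have lL : is_linear L.
  move=> a u v; rewrite LD; congr (_ + _); apply/esym.
  apply: (LC (fun w => a *: w) (complex_modulus a)) => [|w w'|w|n w].
  - exact: sqrtr_ge0.
  - exact: scalerDr.
  - by rewrite hnormZc.
  - by rewrite (linZ (lY _)).
have nL u : hnorm (L u) <= 2 * hnorm u.
  by have := hL 0%N u; rewrite divr1 /Y /= sub0r opp_hnorm.
(* 5 = 2 + (2 + 4) / 2, where 4 uses [|L x| <= 2 |x|]. *)
have LL x : L x = (2^-1)%:C *: (A x + L (L x)).
  apply/eqP; rewrite -subr_eq0; apply/eqP; apply: (small _ (5 * hnorm x)) => n.
  have -> : L x - (2^-1)%:C *: (A x + L (L x)) = - (Y n.+1 x - L x)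
      + (2^-1)%:C *: (Y n (Y n x - L x) + (Y n (L x) - L (L x))).
    apply: rdot_inj => z; rewrite (linB (lY n)) {1}/Y /= -/Y !rdotE; ring.
  apply: le_trans (ler_hnormD _ _) _.
  rewrite opp_hnorm hnorm_scale ger0_norm ?invr_ge0 //.
  have := ler_hnormD (Y n (Y n x - L x)) (Y n (L x) - L (L x)).
  have := nY n (Y n x - L x); have := hL n (L x); have := hL n x.
  have := hL n.+1 x; have /andP[_ y1] := sqrt_bound_ge R n.
  have := ler_wpM2r (h0 (Y n x - L x)) y1; rewrite -/y mul1r.
  have i0 : 0 <= n.+1%:R^-1 :> R by rewrite invr_ge0 ler0n.
  have : 2 * hnorm x / n.+2%:R <= 2 * hnorm x / n.+1%:R.
    by rewrite ler_wpM2l ?mulr_ge0 // lef_pV2 ?posrE ?ltr0Sn // ler_nat.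
  have := ler_wpM2r i0 (nL x); move: i0; set i := n.+1%:R^-1.
  set j := n.+2%:R^-1; lra.
exists (fun x => x - L x); split.
- split=> [a u v|]; last exists 3 => u.
    by rewrite lL scalerBr opprD addrACA.
  apply: le_trans (ler_hnormD _ _) _; rewrite opp_hnorm; have := nL u; lra.
- by move=> u v; rewrite !rdotE sL.
- move=> u; apply: rdot_inj => z; rewrite (linB lL) !rdotE.
  have := congr1 (fun v => rdot v z) (LL u); rewrite !rdotE; lra.
- move=> B bB BA u; have lB := proj1 bB; rewrite (linB lB); congr (_ - _).
  have [M M0 hM] := bounded_op_ge0 bB; apply: (LC _ M) => // [v w|n v].
    exact: linD lB _ _.
  elim: n v => [|n IH] v; rewrite /Y /=; first by rewrite (lin0 lB).
  by rewrite -/Y (linZ lB) (linD lB) BA !IH.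
Qed.

End SqrtIter.

(** * Sums of bounded operators and the Hilbert space [H + K] *)

Lemma bounded_id (R : realType) (H : hilbert R) : bounded_op (fun x : H => x).
Proof. by split=> //; exists 1 => x; rewrite mul1r. Qed.

Lemma bounded_op_add (R : realType) (H K : hilbert R) (A B : H -> K) :
  bounded_op A -> bounded_op B -> bounded_op (fun x => A x + B x).
Proof.
move=> [lA [M hM]] [lB [N hN]]; split=> [a x y|].
  by rewrite lA lB scalerDr addrACA.
exists (M + N) => x; rewrite mulrDl.
exact: le_trans (ler_hnormD _ _) (lerD (hM x) (hN x)).
Qed.

Lemma bounded_op_scale (R : realType) (H K : hilbert R) (c : R) (A : H -> K) :
  bounded_op A -> bounded_op (fun x => c%:C *: A x).
Proof.
move=> [lA [M hM]]; split=> [a x y|].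
  by rewrite lA scalerDr !scalerA [in LHS]mulrC.
exists (`|c| * M) => x; rewrite hnorm_scale -mulrA.
by rewrite ler_wpM2l.
Qed.

Lemma bounded_op_sub (R : realType) (H K : hilbert R) (A B : H -> K) :
  bounded_op A -> bounded_op B -> bounded_op (fun x => A x - B x).
Proof.
move=> [lA [M hM]] [lB [N hN]]; split=> [a x y|].
  by rewrite lA lB scalerBr opprD addrACA.
exists (M + N) => x; rewrite mulrDl.
apply: le_trans (ler_hnormD _ _) _; rewrite opp_hnorm.
exact: lerD (hM x) (hN x).
Qed.

Section DirectSum.
Context (R : realType) (H K : hilbert R).

Definition sum_inner (u v : H * K) : R[i] := hinner u.1 v.1 + hinner u.2 v.2.

Lemma sum_innerDZl a (x y z : H * K) :
  sum_inner (a *: x + y) z = a * sum_inner x z + sum_inner y z.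
Proof. by rewrite /sum_inner /= !hinnerDZl mulrDr addrACA. Qed.

Lemma sum_innerC (x y : H * K) : sum_inner y x = (sum_inner x y)^*.
Proof. by rewrite /sum_inner (hinnerC x.1) (hinnerC x.2) rmorphD. Qed.

Lemma sum_inner_ge0 (x : H * K) : 0 <= sum_inner x x.
Proof. by rewrite addr_ge0 ?hinner_ge0. Qed.

Lemma sum_inner_eq0 (x : H * K) : sum_inner x x = 0 -> x = 0.
Proof.
move/eqP; rewrite paddr_eq0 ?hinner_ge0 //.
move=> /andP[/eqP/hinner_eq0 + /eqP/hinner_eq0].
by case: x => a b /= -> ->.
Qed.

Lemma sum_inner_sqrt (x : H * K) :
  Num.sqrt (complex.Re (sum_inner x x)) =
  Num.sqrt (hnorm x.1 ^+ 2 + hnorm x.2 ^+ 2).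
Proof.
rewrite !hnorm_sqr /rdot /sum_inner.
by case: (hinner x.1 x.1) => ? ?; case: (hinner x.2 x.2).
Qed.

Lemma sum_inner_complete (u : nat -> H * K) :
  (forall e : R, 0 < e -> exists N : nat, forall m n : nat,
     (N <= m)%N -> (N <= n)%N ->
     Num.sqrt (complex.Re (sum_inner (u m - u n) (u m - u n))) < e) ->
  exists l, forall e : R, 0 < e -> exists N : nat, forall n : nat, (N <= n)%N ->
    Num.sqrt (complex.Re (sum_inner (u n - l) (u n - l))) < e.
Proof.
move=> hu.
have [e e0|a ha] := @hcomplete _ H (fun n => (u n).1).
  have [N hN] := hu e e0; exists N => m n Nm Nn.
  apply: le_lt_trans (hN m n Nm Nn); rewrite sum_inner_sqrt ler_sqrt.
    by rewrite hnorm_sqr lerDl sqr_ge0.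
  by rewrite addr_ge0 ?sqr_ge0.
have [e e0|b hb] := @hcomplete _ K (fun n => (u n).2).
  have [N hN] := hu e e0; exists N => m n Nm Nn.
  apply: le_lt_trans (hN m n Nm Nn); rewrite sum_inner_sqrt ler_sqrt.
    by rewrite [X in _ <= _ + X]hnorm_sqr lerDr sqr_ge0.
  by rewrite addr_ge0 ?sqr_ge0.
exists (a, b) => e e0.
have e2 : 0 < e / 2 by rewrite divr_gt0.
have [N hN] := ha _ e2; have [M hM] := hb _ e2.
exists (maxn N M) => n; rewrite geq_max => /andP[Nn Mn].
have h1 : hnorm ((u n).1 - a) < e / 2 := hN n Nn.
have h2 : hnorm ((u n).2 - b) < e / 2 := hM n Mn.
rewrite sum_inner_sqrt /=.
rewrite -[e in _ < e]ger0_norm ?(ltW e0) // -sqrtr_sqr ltr_sqrt ?exprn_gt0 //.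
have := hnorm_ge0 ((u n).1 - a); have := hnorm_ge0 ((u n).2 - b); nra.
Qed.

Definition hsum : hilbert R :=
  Hilbert sum_innerDZl sum_innerC sum_inner_ge0 sum_inner_eq0
    sum_inner_complete.

Lemma rdot_hsum (u v : hsum) : rdot u v = rdot u.1 v.1 + rdot u.2 v.2.
Proof.
rewrite /rdot /= /sum_inner.
by case: (hinner u.1 v.1) => ? ?; case: (hinner u.2 v.2).
Qed.

Lemma bounded_fst : bounded_op (fun u : hsum => u.1).
Proof.
split=> //; exists 1 => x; apply: hnorm_le => //.
by rewrite expr1n mul1r rdot_hsum lerDl rdot_ge0.
Qed.

Lemma bounded_snd : bounded_op (fun u : hsum => u.2).
Proof.
split=> //; exists 1 => x; apply: hnorm_le => //.
by rewrite expr1n mul1r rdot_hsum lerDr rdot_ge0.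
Qed.

Lemma bounded_pair (L : hilbert R) (f : L -> H) (g : L -> K) :
  bounded_op f -> bounded_op g -> @bounded_op R L hsum (fun x => (f x, g x)).
Proof.
move=> bf bg; have [M M0 hM] := bounded_op_ge0 bf.
have [N N0 hN] := bounded_op_ge0 bg; split=> [a x y|].
  by rewrite (proj1 bf) (proj1 bg).
exists (M + N) => x; apply: hnorm_le; first exact: addr_ge0.
rewrite rdot_hsum /= -!hnorm_sqr.
have := hM x; have := hN x; have := hnorm_ge0 (f x); have := hnorm_ge0 (g x).
have x0 := hnorm_ge0 x; have := mulr_ge0 M0 x0; have := mulr_ge0 N0 x0.
set a := hnorm (f x); set b := hnorm (g x) => p q b0 a0 hb ha.
have h1 : a ^+ 2 <= (M * hnorm x) ^+ 2 by rewrite ler_pXn2r ?nnegrE.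
have h2 : b ^+ 2 <= (N * hnorm x) ^+ 2 by rewrite ler_pXn2r ?nnegrE.
have := mulr_ge0 p q; nra.
Qed.

End DirectSum.

(** * The square root [D] of the defect *)

(** With [m] the midpoint and [c] the half-length of [[r^2, 1]], the operator [Q = (P - m) / c] is a
    contraction and [(1 - P) (P - r^2) = c^2 (1 - Q^2)]. So [D] is [c] times the root of
    [1 - Q^2]. *)
Lemma defect_sqrt (R : realType) (r : R) (H : hilbert R) (T Ts : H -> H) :
  0 < r -> r < 1 -> bounded_op T -> adjoint T Ts ->
  (forall x, r * hnorm x <= hnorm (T x)) -> opnorm_le T 1 ->
  exists D : H -> H, [/\ bounded_op D,
    forall x z, rdot (D x) z = rdot x (D z),
    forall x, D (D x) = (1 + r ^+ 2)%:C *: Ts (T x) - Ts (T (Ts (T x)))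
                        - (r ^+ 2)%:C *: x &
    forall B, bounded_op B -> (forall x, B (Ts (T x)) = Ts (T (B x))) ->
      forall x, B (D x) = D (B x)].
Proof.
move=> r0 r1 bT aT lo up.
have r2 : 0 < 1 - r ^+ 2 by nra.
pose P x := Ts (T x); pose c := (1 - r ^+ 2) / 2; pose m := (1 + r ^+ 2) / 2.
have c0 : 0 < c by rewrite divr_gt0.
pose Q x := c^-1%:C *: (P x - m%:C *: x); pose A x := Q (Q x).
have bP : bounded_op P by exact: bounded_op_comp (adjoint_bounded aT bT) bT.
have lP := proj1 bP.
have sP x z : rdot (P x) z = rdot x (P z).
  by rewrite /P (adjoint_rdot (adjointC aT)) (adjoint_rdot aT).
have Pup x : rdot (P x) x <= rdot x x.
  rewrite (adjoint_rdot (adjointC aT)) -!hnorm_sqr.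
  by rewrite ler_pXn2r ?nnegrE ?hnorm_ge0 //; have := up x; rewrite mul1r.
have Plo x : r ^+ 2 * rdot x x <= rdot (P x) x.
  rewrite (adjoint_rdot (adjointC aT)) -!hnorm_sqr -exprMn.
  by rewrite ler_pXn2r ?nnegrE ?mulr_ge0 ?hnorm_ge0 ?(ltW r0).
have bQ : bounded_op Q.
  apply: bounded_op_scale; apply: bounded_op_sub bP _.
  exact: bounded_op_scale (bounded_id H).
have sQ x z : rdot (Q x) z = rdot x (Q z) by rewrite !rdotE sP.
(* With [B := 1 - P] and [C := P - r^2] nonnegative and [B + C = 1 - r^2], the
   operator [(1 - r^2) B C = B C B + C B C] is nonnegative. *)
have BC x :
    0 <= (1 + r ^+ 2) * rdot (P x) x - rdot (P x) (P x) - r ^+ 2 * rdot x x.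
  have := Plo (x - P x); have := Pup (P x - (r ^+ 2)%:C *: x).
  rewrite !(linB lP) !(linZ lP) !rdotE (sP (P x) x) (rdotC x (P x)).
  rewrite -(pmulr_rge0 _ r2); lra.
(* The quantity in [BC] is [c^2 |x|^2 - |P x - m x|^2]. *)
have nQ : opnorm_le Q 1.
  move=> x; apply: hnorm_le => //; rewrite expr1n mul1r !rdotE (rdotC x (P x)).
  have := BC x; set p0 := rdot x x; set p1 := rdot (P x) x.
  set p2 := rdot (P x) (P x) => h.
  rewrite [leRHS](_ : _ = c^-1 * (c^-1 * (c ^+ 2 * p0))); last first.
    by field; rewrite gt_eqF.
  rewrite [leLHS](_ : _ = c^-1 * (c^-1 * (p2 - 2 * m * p1 + m ^+ 2 * p0)));
    last by ring.
  rewrite !ler_pM2l ?invr_gt0 // /c /m; lra.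
have nA : opnorm_le A 1.
  by move=> x; apply: le_trans (nQ _) _; rewrite mul1r nQ.
have sA x z : rdot (A x) z = rdot x (A z) by rewrite /A !sQ.
have [S [bS sS SS SC]] := sqrt_one_sub (proj1 (bounded_op_comp bQ bQ)) nA sA.
exists (fun x => c%:C *: S x); split.
- exact: bounded_op_scale.
- by move=> x z; rewrite !rdotE sS.
- move=> x; rewrite (linZ (proj1 bS)) SS; apply: rdot_inj => z.
  have QE u v : rdot (Q u) v = c^-1 * (rdot (P u) v - m * rdot u v).
    by rewrite !rdotE.
  have AE : rdot (A x) z = c^-1 * (c^-1 * (rdot (P (P x)) z - m * rdot (P x) z)
      - m * (c^-1 * (rdot (P x) z - m * rdot x z))).
    by rewrite /A QE sP !QE -!sP.
  transitivity (c * (c * (rdot x z - rdot (A x) z))).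
    by rewrite 2!rdotZl rdotDl rdotNl.
  rewrite AE !rdotE -[Ts (T x)]/(P x) -[Ts (T (P x))]/(P (P x)) /m /c.
  by field; rewrite gt_eqF.
- move=> B bB BP x; have lB := proj1 bB.
  rewrite (linZ lB) (SC _ bB) // => y.
  have BQ u : B (Q u) = Q (B u).
    by rewrite /Q (linZ lB) (linB lB) (linZ lB) BP.
  by rewrite /A !BQ.
Qed.

(** * The operator equation and the bounds it forces *)

Lemma inv_opE (R : realType) (H : hilbert R) (A B : H -> H) :
  bounded_op A -> bounded_op B -> cancel A B -> cancel B A ->
  invertible_op A /\ inv_op A = B.
Proof.
move=> bA bB AB BA; have iA : invertible_op A by split=> //; exists B.
split=> //; have [_ iAK _] := inv_opP iA.
by apply: boolp.funext => x; rewrite -{1}(BA x) iAK.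
Qed.

Lemma adjoint_cancel (R : realType) (H : hilbert R) (A As : H -> H)
    (B Bs : H -> H) :
  adjoint A As -> adjoint B Bs -> cancel A B -> cancel Bs As.
Proof.
move=> aA aB AB x; apply: rdot_inj => z.
by rewrite !(rdotC _ z) -(adjoint_rdot aA) -(adjoint_rdot aB) AB.
Qed.

Lemma adjoint_comm (R : realType) (H : hilbert R) (A As B Bs : H -> H) :
  adjoint A As -> adjoint B Bs -> (forall x, A (B x) = B (A x)) ->
  forall x, As (Bs x) = Bs (As x).
Proof.
move=> aA aB AB x; apply: rdot_inj => z; rewrite !(rdotC _ z).
rewrite -(adjoint_rdot aA) -(adjoint_rdot aB) -AB.
by rewrite (adjoint_rdot aA) (adjoint_rdot aB).
Qed.

Lemma cancel_comm (S : Type) (A I B : S -> S) : cancel A I -> cancel I A ->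
  (forall x, B (A x) = A (B x)) -> forall x, B (I x) = I (B x).
Proof. by move=> AI IA BA x; rewrite -{2}(IA x) BA AI. Qed.

Definition spectral_eq (R : realType) (r : R) (H : hilbert R) (J : H -> H) :=
  forall y : H, (1 + r ^+ 2)%:C *: op_adj J (J y)
    - op_adj J (J (op_adj J (J y))) - (r ^+ 2)%:C *: y = 0.

Lemma gram_inverse (R : realType) (H : hilbert R) (J : H -> H) :
  invertible_op J ->
  cancel (fun y => op_adj J (J y))
         (fun y => inv_op J (op_adj (inv_op J) y)) /\
  cancel (fun y => inv_op J (op_adj (inv_op J) y))
         (fun y => op_adj J (J y)).
Proof.
move=> iJ; have [bI JI IJ] := inv_opP iJ.
have aJ := op_adjP (proj1 iJ); have aI := op_adjP bI.
split=> y /=; first by rewrite (adjoint_cancel aI aJ IJ) JI.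
by rewrite IJ (adjoint_cancel aJ aI JI).
Qed.

(** Each form is the other one evaluated at [P^-1 y] or at [P y], where [P = J^* J]. *)
Lemma spectral_eqP (R : realType) (r : R) (H : hilbert R) (J : H -> H) :
  invertible_op J ->
  spectral_eq r J <->
  forall y, (1 + r ^+ 2)%:C *: y - op_adj J (J y)
    - (r ^+ 2)%:C *: inv_op J (op_adj (inv_op J) y) = 0.
Proof.
move=> iJ; have [PM MP] := gram_inverse iJ; split=> h y.
  by have := h (inv_op J (op_adj (inv_op J) y)); rewrite MP.
by have := h (op_adj J (J y)); rewrite PM.
Qed.

(** The equation reduces [P^2] to degree one, so that [|x - P x|^2 = (1 - r^2) (|x|^2 - |J x|^2)]
    and [|P x - r^2 x|^2 = (1 - r^2) (|J x|^2 - r^2 |x|^2)]; both are nonnegative. *)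
Lemma spectral_eq_bounds (R : realType) (r : R) (H : hilbert R) (J : H -> H) :
  0 < r -> r < 1 -> bounded_op J -> spectral_eq r J ->
  forall x, r * hnorm x <= hnorm (J x) <= hnorm x.
Proof.
move=> r0 r1 bJ hJ x; have aJ := adjoint_rdot (op_adjP bJ).
have aJ' := adjoint_rdot (adjointC (op_adjP bJ)).
have r2 : 0 < 1 - r ^+ 2 by nra.
set P := fun y => op_adj J (J y) in hJ.
have sP u v : rdot (P u) v = rdot u (P v) by rewrite /P aJ' aJ.
have P1 : rdot (P x) x = rdot (J x) (J x) by rewrite /P aJ'.
have P2 : rdot (P x) (P x) =
    (1 + r ^+ 2) * rdot (J x) (J x) - r ^+ 2 * rdot x x.
  have := congr1 (fun v => rdot v x) (hJ x).
  by rewrite !rdotE rdot0l -!/(P _) (sP (P x)) -!P1; lra.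
have := rdot_ge0 (P x - (r ^+ 2)%:C *: x); have := rdot_ge0 (x - P x).
rewrite !rdotE (rdotC x) P2 P1 => h1 h2.
apply/andP; split; rewrite -[leRHS]mul1r.
  rewrite mul1r -(@ler_pXn2r _ 2) ?nnegrE ?mulr_ge0 ?hnorm_ge0 ?(ltW r0) //.
  by rewrite exprMn !hnorm_sqr -(ler_pM2l r2); lra.
apply: hnorm_le => //; rewrite expr1n mul1r -(ler_pM2l r2); lra.
Qed.

(** * The operators [A + A] on [H + H] *)

Section Diagonal.
Context (R : realType) (H : hilbert R).

Definition diag_op (A : H -> H) (u : hsum H H) : hsum H H := (A u.1, A u.2).

Lemma diag_bounded A : bounded_op A -> bounded_op (diag_op A).
Proof.
move=> bA; exact: bounded_pair (bounded_op_comp bA (bounded_fst H H))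
  (bounded_op_comp bA (bounded_snd H H)).
Qed.

Lemma diag_adjoint A As : adjoint A As -> adjoint (diag_op A) (diag_op As).
Proof. by move=> aA u v; rewrite /= /sum_inner /= !aA. Qed.

Lemma diag_inv A : invertible_op A ->
  invertible_op (diag_op A) /\ inv_op (diag_op A) = diag_op (inv_op A).
Proof.
move=> iA; have [bI AI IA] := inv_opP iA.
apply: inv_opE; [exact: diag_bounded (proj1 iA)|exact: diag_bounded| |].
- by case=> a b; rewrite /diag_op /= !AI.
- by case=> a b; rewrite /diag_op /= !IA.
Qed.

Lemma diag_opnorm A (M : R) :
  0 <= M -> opnorm_le A M -> opnorm_le (diag_op A) M.
Proof.
move=> M0 hM u; apply: hnorm_le => //; rewrite !rdot_hsum mulrDr -!hnorm_sqr.
rewrite -!exprMn; apply: lerD;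
  by rewrite ler_pXn2r ?nnegrE ?mulr_ge0 ?hnorm_ge0 //; apply: hM.
Qed.

Lemma diag_C1r (r : R) A : C1r r A -> C1r r (diag_op A).
Proof.
move=> [iA [nA nI]]; have [iD eI] := diag_inv iA; split=> //; split.
  exact: diag_opnorm.
rewrite eI.
exact: (@diag_opnorm (fun x => r%:C *: inv_op A x)).
Qed.

Lemma diag_spectral_eq (r : R) A : bounded_op A -> spectral_eq r A ->
  spectral_eq r (diag_op A).
Proof.
move=> bA hA u; rewrite !(op_adjE (diag_adjoint (op_adjP bA))).
by case: u => a b; rewrite /diag_op /=; congr (_, _); exact: hA.
Qed.

End Diagonal.

(** * Dilation of one operator *)

(* [T] is the restriction of [J = [[T, T^-* D], [0, r T^-*]]] to the first
   summand, and [J^* J = [[P, D], [D, 1 + r^2 - P]]] for [P = T^* T] and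
   [D^2 = (1 - P) (P - r^2)]. *)
Lemma single_dilation (R : realType) (r : R) (H : hilbert R) (T : H -> H) :
  0 < r -> r < 1 -> C1r r T ->
  exists J Js : hsum H H -> hsum H H,
    [/\ invertible_op J, adjoint J Js, spectral_eq r J,
        forall x, J (x, 0) = (T x, 0) &
        forall S, bounded_op S -> (forall x, S (T x) = T (S x)) ->
          (forall x, S (op_adj T x) = op_adj T (S x)) ->
          (forall u, diag_op S (J u) = J (diag_op S u)) /\
          (forall u, diag_op S (Js u) = Js (diag_op S u))].
Proof.
move=> r0 r1 [iT [nT nI]]; have [bI TI IT] := inv_opP iT.
have bT := proj1 iT; have aT := op_adjP bT; have aI := op_adjP bI.
set I := inv_op T in bI TI IT aI nI *; set Ts := op_adj T in aT *.
set N := op_adj I in aI.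
have bTs := adjoint_bounded aT bT; have bN := adjoint_bounded aI bI.
have TsN : cancel N Ts := adjoint_cancel aT aI TI.
have NTs : cancel Ts N := adjoint_cancel aI aT IT.
have [lI lT] := (proj1 bI, proj1 bT); have [lN lTs] := (proj1 bN, proj1 bTs).
have lo x : r * hnorm x <= hnorm (T x).
  by have := nI (T x); rewrite hnorm_scale ger0_norm ?(ltW r0) // TI mul1r.
have [D [bD sD DD DC]] := defect_sqrt r0 r1 bT aT lo nT.
have lD := proj1 bD; have rn0 : r != 0 by rewrite gt_eqF.
(* Triangular factor of the prescribed Gram matrix: [T^* b = D] gives [b = T^-* D], and then
   [1 + r^2 - P - b^* b = r^2 P^-1], which is [c^* c] for [c = r T^-*]. *)
pose J (u : hsum H H) : hsum H H := (T u.1 + N (D u.2), r%:C *: N u.2).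
pose Js (u : hsum H H) : hsum H H := (Ts u.1, D (I u.1) + r%:C *: I u.2).
pose Ji (u : hsum H H) : hsum H H :=
  (I u.1 - r^-1%:C *: I (N (D (Ts u.2))), r^-1%:C *: Ts u.2).
have b1 := bounded_fst H H; have b2 := bounded_snd H H.
have bJ : bounded_op J.
  apply: bounded_pair.
    exact: bounded_op_add (bounded_op_comp bT b1)
      (bounded_op_comp bN (bounded_op_comp bD b2)).
  exact: bounded_op_scale (bounded_op_comp bN b2).
have bJi : bounded_op Ji.
  apply: bounded_pair; last exact: bounded_op_scale (bounded_op_comp bTs b2).
  apply: bounded_op_sub (bounded_op_comp bI b1) (bounded_op_scale _ _).
  exact: bounded_op_comp bI (bounded_op_comp bN (bounded_op_comp bD
    (bounded_op_comp bTs b2))).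
have rK (x : H) : r%:C *: (r^-1%:C *: x) = x.
  by apply: rdot_inj => z; rewrite !rdotE mulrA divff // mul1r.
have rK' (x : H) : r^-1%:C *: (r%:C *: x) = x.
  by apply: rdot_inj => z; rewrite !rdotE mulrA mulVf // mul1r.
have JK : cancel J Ji.
  case=> x y; rewrite /J /Ji /= (linZ lTs) TsN rK'; congr (_, _).
  by rewrite (linZ lD) (linZ lN) (linZ lI) rK' (linD lI) TI addrK.
have JiK : cancel Ji J.
  case=> x y; rewrite /J /Ji /= (linZ lN) NTs rK; congr (_, _).
  by rewrite (linB lT) (linZ lT) !IT (linZ lD) (linZ lN) subrK.
have aJ : adjoint J Js.
  apply: rdot_adjoint (proj1 bJ) _ => u v; rewrite !rdot_hsum /= !rdotE.
  rewrite (adjoint_rdot aT) !(adjoint_rdot (adjointC aI)) sD; ring.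
have [iJ _] := inv_opE bJ bJi JK JiK.
exists J, Js; split=> //.
- have bP := bounded_op_comp bTs bT; have DP z := DC _ bP (fun=> erefl) z.
  have JJ x y : Js (J (x, y)) = (Ts (T x) + D y,
      D x + (1 + r ^+ 2)%:C *: y - Ts (T y)).
    rewrite /Js /J /=; congr (_, _); first by rewrite (linD lTs) TsN.
    have IN : forall z, I (N (Ts (T z))) = z by move=> z; rewrite NTs TI.
    have DIN z : D (I (N z)) = I (N (D z)).
      apply: (cancel_comm (A := fun z => Ts (T z)) (I := fun z => I (N z))).
      - exact: IN.
      - by move=> w; rewrite IT TsN.
      - by move=> w; exact/esym/DP.
    (* [P^-1 D^2 = 1 + r^2 - P - r^2 P^-1], whose last term cancels against that of the lower right
       entry of [J]. *)
    rewrite (linD lI) TI (linD lD) DIN DD.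
    rewrite !(linB lN) !(linB lI) !(linZ lN) !(linZ lI) !IN.
    by apply: rdot_inj => z; rewrite !rdotE; ring.
  move=> [x y]; rewrite !(op_adjE aJ) !JJ; congr (_, _) => /=.
  + rewrite (linD lT) (linD lTs) (linB lD) (linD lD) (linZ lD) DD -DP /=.
    by apply: rdot_inj => z; rewrite !rdotE rdot0l; ring.
  + rewrite (linD lD) DD (linB lT) (linB lTs) (linD lT) (linD lTs).
    rewrite (linZ lT) (linZ lTs) -!DP /=.
    by apply: rdot_inj => z; rewrite !rdotE rdot0l; ring.
- by move=> x; rewrite /J /= (lin0 lD) (lin0 lN) addr0 scaler0.
- move=> S bS ST STs.
  have lS := proj1 bS.
  have SI : forall x, S (I x) = I (S x) by exact: cancel_comm TI IT ST.
  have SN : forall x, S (N x) = N (S x) by exact: cancel_comm NTs TsN STs.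
  have SD : forall x, S (D x) = D (S x).
    by apply: DC => // x; rewrite STs ST.
  split; case=> x y; rewrite /diag_op /J /Js /=; congr (_, _).
  + by rewrite (linD lS) ST SN SD.
  + by rewrite (linZ lS) SN.
  + by rewrite STs.
  + by rewrite (linD lS) (linZ lS) SD !SI.
Qed.

(** * Dilation of the tuple, one index at a time *)

(** Besides solving the equation at [k], the step must preserve what was achieved at treated indices
    and keep the untreated ones in [C1r]; both hold because the other operators become diagonal. *)
Lemma dilation_step (R : realType) (r : R) (H : hilbert R) (d : nat)
    (T : 'I_d -> H -> H) (k : 'I_d) :
  0 < r -> r < 1 -> (forall i, invertible_op (T i)) -> doubly_commuting T ->
  C1r r (T k) ->
  exists (K : hilbert R) (V : H -> K) (J : 'I_d -> K -> K),
    [/\ op_isometry V, forall i, invertible_op (J i), doubly_commuting J,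
      forall i x, J i (V x) = V (T i x) & forall i,
      (i = k \/ spectral_eq r (T i) -> spectral_eq r (J i)) /\
      (i <> k -> C1r r (T i) -> C1r r (J i))].
Proof.
move=> r0 r1 iT [TT TTs] Ck.
have [Jk [Jks [iJk aJk eJk JkV JkC]]] := single_dilation r0 r1 Ck.
have aT i := op_adjP (proj1 (iT i)).
have TsT i j := adjoint_comm (aT i) (aT j) (TT i j).
have adjb i : bounded_op (op_adj (T i)) := adjoint_bounded (aT i) (proj1 (iT i)).
pose J i : hsum H H -> hsum H H := if i == k then Jk else diag_op (T i).
have Jkk : J k = Jk by rewrite /J eqxx.
have Jnk i : i != k -> J i = diag_op (T i) by rewrite /J => /negbTE ->.
have JS j u : j != k -> J j (Jk u) = Jk (J j u).
  move=> jk; rewrite Jnk //.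
  apply: (JkC _ (proj1 (iT j)) (TT j k) _).1; exact: TTs.
exists (hsum H H), (fun x => (x, 0)), J; split.
- split=> [a x y|x]; first by rewrite -[RHS]/(_, _) /= scaler0 addr0.
  rewrite {1}/hnorm -[complex.Re _]/(rdot ((x, 0) : hsum H H) (x, 0)).
  by rewrite rdot_hsum /= rdot0l addr0.
- move=> i; have [->|ik] := eqVneq i k; first by rewrite Jkk.
  by rewrite Jnk //; case: (diag_inv (iT i)).
- split=> [i j u|i j ij u].
    have [->|ik] := eqVneq i k; have [->|jk] := eqVneq j k; rewrite ?Jkk //.
    + by rewrite JS.
    + by rewrite JS.
    + by rewrite !Jnk // /diag_op /= !(TT i j).
  have [ik|ik] := eqVneq i k; have [jk|jk] := eqVneq j k.
  + by rewrite ik jk eqxx in ij.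
  + rewrite ik Jkk Jnk // !(op_adjE (diag_adjoint (aT j))); apply/esym.
    (* Here the commutant property is applied to [S = T_j^*], which commutes with [T_k^*] by taking
       adjoints. *)
    apply: (JkC _ (adjb j) _ _).1 => x; first by rewrite TTs // eq_sym.
    exact: TsT.
  + rewrite jk Jkk Jnk // !(op_adjE aJk).
    apply: (JkC _ (proj1 (iT i)) (TT i k) _).2; exact: TTs.
  + rewrite !Jnk // !(op_adjE (diag_adjoint (aT j))).
    by rewrite /diag_op /= !(TTs i j).
- move=> i x; have [->|ik] := eqVneq i k; first by rewrite Jkk JkV.
  by rewrite Jnk // /diag_op /= (lin0 (proj1 (proj1 (iT i)))).
- move=> i; split.
    have [->|ik] := eqVneq i k; first by rewrite Jkk.
    case=> [/eqP|hi]; first by rewrite (negbTE ik).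
    by rewrite Jnk //; apply: diag_spectral_eq (proj1 (iT i)) hi.
  by move=> /eqP ik Ci; rewrite Jnk //; apply: diag_C1r.
Qed.

Lemma dilation (R : realType) (r : R) (H : hilbert R) (d : nat)
    (T : 'I_d -> H -> H) :
  0 < r -> r < 1 -> (forall i, invertible_op (T i)) -> doubly_commuting T ->
  (forall i, C1r r (T i)) ->
  exists (K : hilbert R) (V : H -> K) (J : 'I_d -> K -> K),
    [/\ op_isometry V, forall i, invertible_op (J i), doubly_commuting J,
      forall i x, J i (V x) = V (T i x) & forall i, spectral_eq r (J i)].
Proof.
move=> r0 r1 iT TT CT.
suff step n : (n <= d)%N ->
    exists (K : hilbert R) (V : H -> K) (J : 'I_d -> K -> K),
    [/\ op_isometry V, forall i, invertible_op (J i), doubly_commuting J,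
      forall i x, J i (V x) = V (T i x) & forall i : 'I_d,
        if (i < n)%N then spectral_eq r (J i) else C1r r (J i)].
  have [K [V [J [? ? ? ? h]]]] := step d (leqnn d).
  by exists K, V, J; split=> // i; have := h i; rewrite ltn_ord.
elim: n => [_|n IH nd].
  exists H, id, T; split=> //; split=> //.
have [K [V [J [[lV nV] iJ JJ JV h]]]] := IH (ltnW nd).
pose k := Ordinal nd; have Ck : C1r r (J k) by have := h k; rewrite ltnn.
have [K' [V' [J' [[lV' nV'] iJ' JJ' JV' h']]]] := dilation_step r0 r1 iJ JJ Ck.
exists K', (V' \o V), J'; split=> //.
- split=> [a x y|x] /=; first by rewrite lV lV'.
  by rewrite nV' nV.
- by move=> i x /=; rewrite JV' JV.
- move=> i; have [h1 h2] := h' i; have := h i; rewrite ltnS.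
  case: ltngtP => [_|ni|ik] hi.
  + by apply: h1; right.
  + by apply: h2 => // E; rewrite E ltnn in ni.
  + by apply: h1; left; apply: val_inj.
Qed.

(** * Passing between [J] and [T] *)

Lemma isometry_adjoint (R : realType) (H K : hilbert R) (V : H -> K) :
  op_isometry V -> [/\ adjoint V (op_adj V), opnorm_le (op_adj V) 1 &
    forall x, op_adj V (V x) = x].
Proof.
move=> [lV nV]; have bV : bounded_op V.
  by split=> //; exists 1 => x; rewrite mul1r nV.
have aV := op_adjP bV; split=> //.
  by apply: adjoint_opnorm aV _ => // x; rewrite mul1r nV.
(* Polarization, as isometries are defined by norms only. *)
have VV x y : rdot (V x) (V y) = rdot x y.
  have := hnorm_sqr (V (x + y)); have := hnorm_sqr (x + y).
  rewrite nV => ->; rewrite (linD lV) !rdotE -!hnorm_sqr !nV.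
  rewrite (rdotC (V y)) (rdotC y); lra.
move=> x; apply: rdot_inj => z.
by rewrite (rdotC _ z) -(adjoint_rdot aV) VV rdotC.
Qed.

(** Negative powers follow because [T_i] is onto: [J_i (V w) = V (T_i w)] with [w = T_i^-1 z] reads
    [J_i^-1 (V z) = V (T_i^-1 z)]. *)
Lemma multi_pow_intertwine (R : realType) (H K : hilbert R) (d : nat)
    (T : 'I_d -> H -> H) (J : 'I_d -> K -> K) (V : H -> K) (n : 'I_d -> int) :
  (forall i, invertible_op (T i)) -> (forall i, invertible_op (J i)) ->
  (forall i x, J i (V x) = V (T i x)) ->
  forall x, multi_pow J n (V x) = V (multi_pow T n x).
Proof.
move=> iT iJ JV x; rewrite /multi_pow; elim: (enum _) => //= i s ->.
set y := foldr _ _ _ _.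
have IV z : inv_op (J i) (V z) = V (inv_op (T i) z).
  have [_ TI IT] := inv_opP (iT i); have [_ JI IJ] := inv_opP (iJ i).
  by rewrite -{1}(IT z) -JV JI.
case: (n i) => m; rewrite /op_zpow.
  by elim: m => //= m ->; rewrite JV.
by elim: m.+1 => //= p ->; rewrite IV.
Qed.

Lemma multi_pow_single (R : realType) (H : hilbert R) (d : nat)
    (T : 'I_d -> H -> H) (i : 'I_d) (m : int) (x : H) :
  multi_pow T (fun j => if j == i then m else 0) x = op_zpow (T i) m x.
Proof.
rewrite /multi_pow; have := enum_uniq 'I_d; have := mem_enum 'I_d i.
have notin s : i \notin s -> foldr (fun j acc =>
    op_zpow (T j) (if j == i then m else 0) \o acc) id s x = x.
  by elim: s => //= j s IH; rewrite inE negb_or eq_sym => /andP[/negbTE -> /IH].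
rewrite inE; elim: (enum _) => //= j s IH; rewrite inE.
have [<-|ij] := eqVneq i j => /=; first by move=> _ /andP[/notin -> _].
by move=> /IH + /andP[_ us] => ->.
Qed.

Theorem theorem1p2 (R : realType) (r : R) (H : hilbert R) (d : nat)
    (T : 'I_d -> H -> H) :
  0 < r -> r < 1 ->
  (forall i, invertible_op (T i)) -> doubly_commuting T ->
  ((forall i, C1r r (T i)) <->
   exists (K : hilbert R) (V : H -> K) (J : 'I_d -> K -> K),
     op_isometry V /\
     (forall i, invertible_op (J i)) /\ doubly_commuting J /\
     (forall (n : 'I_d -> int) (x : H),
        multi_pow T n x = op_adj V (multi_pow J n (V x))) /\
     (forall (m : 'I_d) (y : K),
        (1 + r ^+ 2)%:C *: y - op_adj (J m) (J m y)
          - (r ^+ 2)%:C *: inv_op (J m) (op_adj (inv_op (J m)) y) = 0)).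
Proof.
move=> r0 r1 iT TT; split=> [CT|[K [V [J [oV [iJ [JJ [TJ eJ]]]]]]] i].
  have [K [V [J [oV iJ JJ JV eJ]]]] := dilation r0 r1 iT TT CT.
  have [_ _ VK] := isometry_adjoint oV.
  exists K, V, J; split=> //; split=> //; split=> //; split.
  - by move=> n x; rewrite (multi_pow_intertwine n iT iJ JV) VK.
  - by move=> m; apply/spectral_eqP.
have [_ nVs VK] := isometry_adjoint oV; have [_ nV] := oV.
have [[_ JI IJ] [_ TI IT]] := (inv_opP (iJ i), inv_opP (iT i)).
have hJ := spectral_eq_bounds r0 r1 (proj1 (iJ i))
  (proj2 (spectral_eqP r (iJ i)) (eJ i)).
have T1 x : T i x = op_adj V (J i (V x)).
  by have := TJ (fun j => if j == i then 1 else 0) x; rewrite !multi_pow_single.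
(* The exponent [- 1] is [Negz 0], for which [op_zpow] is a single [inv_op]. *)
have T2 x : inv_op (T i) x = op_adj V (inv_op (J i) (V x)).
  have := TJ (fun j => if j == i then - 1 else 0) x.
  by rewrite !multi_pow_single.
split=> //; split=> x.
  rewrite T1 mul1r; apply: le_trans (nVs _) _; rewrite mul1r -(nV x).
  by case/andP: (hJ (V x)).
(* The lower bound on [J_i], used at [J_i^-1 (V x)], is the bound on [r J_i^-1]. *)
rewrite hnorm_scale ger0_norm ?(ltW r0) // T2 mul1r.
have := nVs (inv_op (J i) (V x)).
rewrite mul1r => /(ler_wpM2l (ltW r0)) /le_trans; apply.
by have /andP[+ _] := hJ (inv_op (J i) (V x)); rewrite IJ nV.
Qed.
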